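(* Let $a,b$ be positive integers and let $\{F_n(q)\}_{n\geq 0}$ be the $q$-biperiodic Fibonacci sequence. For every integer $n\geq 0$, $$F_{2n+2}(q)=a\sum_{i=0}^n\sum_{j=0}^n(ab)^{\xi(n-i-j)}q^{i^2+(n+i+1)j} {n-j\brack i}{n-i\brack j}(ab)^{2\left\lfloor \frac{n-i-j}{2} \right\rfloor}.$$
   Context: Fix positive integers $a,b$; $q$ is an indeterminate. For an integer $n$, $\xi(n)=n-2\lfloor n/2\rfloor$ (so $\xi(n)=0$ if $n$ is even and $1$ if $n$ is odd). The $q$-biperiodic Fibonacci sequence is defined by $F_0(q)=0$, $F_1(q)=1$ and, for $n\geq 2$, $F_n(q)=aF_{n-1}(q)+q^{n-2}F_{n-2}(q)$ if $n$ is even, $F_n(q)=bF_{n-1}(q)+q^{n-2}F_{n-2}(q)$ if $n$ is odd. The $q$-binomial coefficient is ${n\brack k}=\frac{[n]_q!}{[k]_q!\,[n-k]_q!}$ for $0\leq k\leq n$ and ${n\brack k}=0$ for $k<0$ or $k>n\geq 0$, where $[n]_q=1+q+\cdots+q^{n-1}$ and $[n]_q!=[1]_q[2]_q\cdots[n]_q$, $[0]_q!=1$. Terms with a vanishing $q$-binomial coefficient are zero (even if the exponent of $ab$ is negative). *)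

(* Defs.v *)
From mathcomp Require Import all_boot all_order all_algebra.

Set Implicit Arguments.
Unset Strict Implicit.
Unset Printing Implicit Defensive.

Import GRing.Theory.
Local Open Scope ring_scope.

(* The field of fractions of Z[q]. The indeterminate q is 'X in {poly int}, *)
(* and its image tofrac 'X here.                                            *)
Definition Zq : fieldType := {fraction {poly int}}.

Definition qvar : Zq := tofrac 'X.

Fixpoint qbifib (a b n : nat) {struct n} : {poly int} :=
  match n with
  | 0 => 0
  | 1 => 1
  | (m.+1 as p).+1 =>
      (if odd n then b else a)%:R * qbifib a b p + 'X^m * qbifib a b m
  end.

Definition qint (n : nat) : Zq := \sum_(0 <= i < n) qvar ^+ i.

Definition qfact (n : nat) : Zq := \prod_(1 <= i < n.+1) qint i.

Definition qbinom (n k : nat) : Zq :=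
  if (k <= n)%N then qfact n / (qfact k * qfact (n - k)) else 0.

(* The integer division divz by 2 rounds towards minus infinity, so that it *)
(* is the floor of m / 2 for negative m as well.                            *)
Definition floor_half (m : int) : int := (m %/ 2)%Z.

Definition xi (m : int) : int := m - 2 * floor_half m.

(* Main.v *)
Require Import Defs.
From mathcomp Require Import all_boot all_order all_algebra.
From mathcomp Require Import zify ring.

Import GRing.Theory Num.Theory.
Local Open Scope ring_scope.

(* Since xi m + 2 * floor_half m = m, the summand carries (ab)^(n-i-j). On the
   antidiagonal i + j = k both q-binomials have the form [n-k+l, l], and a
   q-Vandermonde convolution of complete homogeneous symmetric polynomials sums
   them to q^(k^2) [2n+1-k, k]. What remains is the single-sum formula
   F_(2n+2) = a sum_k (ab)^(n-k) q^(k^2) [2n+1-k, k], which follows from the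
   q-Pascal rule by induction, simultaneously with
   F_(2n+1) = sum_k (ab)^(n-k) q^(k^2) [2n-k, k]. *)

Lemma qint_neq0 n : qint n.+1 != 0.
Proof.
have -> : qint n.+1 = tofrac (\sum_(0 <= i < n.+1) 'X^i : {poly int}).
  by rewrite /qint rmorph_sum; apply: eq_bigr => i _; rewrite rmorphXn.
(* The constant coefficient of this polynomial is 1. *)
rewrite tofrac_eq0; apply/negP => /eqP/(congr1 (coefp 0)); rewrite /=.
by rewrite big_nat_recl // coefD coef_sum big1 ?coef0 ?expr0 ?coef1 // => i _;
  rewrite coefXn.
Qed.

Lemma qfactS n : qfact n.+1 = qfact n * qint n.+1.
Proof. by rewrite /qfact big_nat_recr. Qed.

Lemma qfact_neq0 n : qfact n != 0.
Proof.
elim: n => [|n IHn]; first by rewrite /qfact big_nil oner_neq0.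
by rewrite qfactS mulf_neq0 ?qint_neq0.
Qed.

Lemma qintD m n : qint (m + n) = qint m + qvar ^+ m * qint n.
Proof.
rewrite /qint (@big_cat_nat _ _ _ m) ?leq_addr //= -{2}[m]add0n.
rewrite big_addn addKn mulr_sumr; congr (_ + _).
by apply: eq_bigr => i _; rewrite -exprD addnC.
Qed.

Lemma qbinom0 n : qbinom n 0 = 1.
Proof.
by rewrite /qbinom leq0n subn0 /qfact big_nil mul1r divff ?qfact_neq0.
Qed.

Lemma qbinom_small n k : (n < k)%N -> qbinom n k = 0.
Proof. by rewrite ltnNge /qbinom => /negbTE ->. Qed.

Lemma qbinomS n k : (k <= n)%N ->
  qbinom n.+1 k.+1 = qbinom n k.+1 + qvar ^+ (n - k) * qbinom n k.
Proof.
move=> le_kn; have [m ->] : exists m, n = (k + m)%N by exists (n - k)%N; lia.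
rewrite addKn /qbinom ltnS leq_addr subSS addKn.
(* For [m = 0] the term [k, k+1] is 0 by convention, not a quotient of factorials. *)
case: m => [|m].
  rewrite addn0 ltnn add0r mul1r /=.
  by rewrite !invfM !mulVKf ?qfact_neq0 // !mulrA !divff ?qfact_neq0.
rewrite ifT; last lia.
have -> : (k + m.+1 - k.+1 = m)%N by lia.
rewrite (qfactS (k + m.+1)) (qfactS k) (qfactS m).
(* With [m.+1] first, [qintD] puts the factor q^(m+1) = q^(n-k) on [k+1]. *)
have -> : (k + m.+1).+1 = (m.+1 + k.+1)%N by lia.
rewrite qintD.
move: (qfact_neq0 k) (qfact_neq0 m) (qint_neq0 k) (qint_neq0 m).
have pascal (F : fieldType) (N K M A B Q : F) :
    K != 0 -> M != 0 -> A != 0 -> B != 0 ->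
    N * (B + Q * A) / (K * A * (M * B))
      = N / (K * A * M) + Q * (N / (K * (M * B))).
  by move=> nzK nzM nzA nzB; field; rewrite nzB nzM nzK.
exact: pascal.
Qed.

(* The Gaussian binomial [(r + k).-1, k] is the complete homogeneous symmetric
   polynomial of degree k in 1, q, ..., q^(r-1); for r = 0 the truncated
   predecessor still gives the right value, 1 if k = 0 and 0 otherwise. *)
Lemma qVandermonde r s k :
  \sum_(0 <= j < k.+1)
      qvar ^+ (r * j) * qbinom (r + (k - j)).-1 (k - j) * qbinom (s + j).-1 j
    = qbinom (r + s + k).-1 k.
Proof.
elim: s k => [|s IHs] k.
  rewrite big_nat_recl // big1_seq; last first.
    by move=> j _; rewrite (@qbinom_small (0 + j.+1).-1) ?mulr0.
  by rewrite muln0 subn0 !qbinom0 expr0 mul1r mulr1 !addr0 !addn0.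
elim: k => [|k IHk]; first by rewrite big_nat1 !subn0 !qbinom0 muln0 !mul1r.
(* Pascal's rule separates the monomials without the last variable q^(r+s) from those divisible by
   it. *)
have -> : (r + s.+1 + k.+1).-1 = (r + s + k).+1 by lia.
rewrite qbinomS ?leq_addl // addnK.
have -> : qbinom (r + s + k) k.+1 = qbinom (r + s + k.+1).-1 k.+1.
  by congr qbinom; lia.
have -> : qbinom (r + s + k) k = qbinom (r + s.+1 + k).-1 k.
  by congr qbinom; lia.
rewrite -IHs -IHk mulr_sumr [LHS]big_nat_recl // [X in _ = X + _]big_nat_recl //.
rewrite -addrA -big_split /= !qbinom0; congr (_ + _).
apply: eq_bigr => j _; rewrite subSS.
rewrite addnS qbinomS ?leq_addl // addnK mulnS !exprD. 
by ring.
Qed.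

(** At x = ab this is F_(N+1) for even N and F_(N+1)/a for odd N, so one recurrence serves both
    parities. *)
Definition fibsum (x : Zq) N : Zq :=
  \sum_(0 <= k < N./2.+1) x ^+ (N./2 - k) * qvar ^+ (k ^ 2) * qbinom (N - k) k.

Lemma fibsumSS x N :
  fibsum x N.+2 = (if odd N then 1 else x) * fibsum x N.+1
                  + qvar ^+ N.+1 * fibsum x N.
Proof.
set n := N./2.
(* For even N the half of N+1 is still n: the factor x raises each exponent by one, and the added
   term k = n+1 contains [n, n+1] = 0. *)
have -> : (if odd N then 1 else x) * fibsum x N.+1 =
   \sum_(0 <= k < n.+2) x ^+ (n.+1 - k) * qvar ^+ (k ^ 2) * qbinom (N.+1 - k) k.
  rewrite /fibsum /=; have := odd_double_half N; rewrite -/n => NE.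
  rewrite uphalf_half -/n; case: (odd N) NE => NE; first by rewrite mul1r.
  rewrite [RHS]big_nat_recr //= (@qbinom_small (N.+1 - n.+1)); last lia.
  rewrite mulr0 addr0 mulr_sumr; apply: eq_big_nat => k /andP[_ lt_kn].
  by rewrite add0n (subSn (lt_kn : (k <= n)%N)) exprS !mulrA.
rewrite /fibsum /= -/n mulr_sumr [LHS]big_nat_recl // [X in _ = X + _]big_nat_recl //.
rewrite -addrA -big_split /= !qbinom0; congr (_ + _).
apply: eq_big_nat => k /andP[_ lt_kn]; have := odd_double_half N => NE.
have le_kn : (k + k <= N)%N by rewrite -/n in NE; lia.
have -> : (N.+2 - k.+1 = (N - k).+1)%N by lia.
rewrite !subSS qbinomS; last lia.
(* Since (k+1)^2 + (N-2k) = k^2 + (N+1), the power q^(N+1) factors out uniformly in k. *)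
have -> : (k.+1 ^ 2 = k ^ 2 + k + k + 1)%N by lia.
have -> : N.+1 = (k + k + 1 + (N - k - k))%N by lia.
by rewrite !exprD; ring.
Qed.

Lemma qbifib_fibsum a b N :
  tofrac (qbifib a b N.+1) = (if odd N then a%:R else 1) * fibsum (a * b)%:R N.
Proof.
suff [] : tofrac (qbifib a b N.+1)
            = (if odd N then a%:R else 1) * fibsum (a * b)%:R N
       /\ tofrac (qbifib a b N.+2)
            = (if odd N.+1 then a%:R else 1) * fibsum (a * b)%:R N.+1 by [].
elim: N => [|N [IH1 IH2]].
  rewrite /fibsum /= !big_nat1 !qbinom0 !expr0 mulr0 addr0 mulr1.
  by rewrite !mulr1 rmorph1 rmorph_nat.
split=> //; rewrite fibsumSS.
have -> : qbifib a b N.+3 = (if odd N.+3 then b else a)%:R * qbifib a b N.+2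
                            + 'X^(N.+1) * qbifib a b N.+1 by [].
rewrite tofracD !tofracM rmorph_nat tofracXn IH1 IH2 -/qvar /= natrM.
by case: (odd N) => /=; ring.
Qed.

Lemma sum_antidiagonals (V : nmodType) (f : nat -> nat -> V) n :
  (forall i j, (n < i + j)%N -> f i j = 0) ->
  \sum_(0 <= i < n.+1) \sum_(0 <= j < n.+1) f i j
    = \sum_(0 <= k < n.+1) \sum_(0 <= j < k.+1) f (k - j)%N j.
Proof.
move=> f0; rewrite exchange_big_nat.
transitivity
  (\sum_(0 <= j < n.+1) \sum_(0 <= k < n.+1 | (j <= k)%N) f (k - j)%N j).
  apply: eq_big_nat => j /andP[_ lt_jn].
  rewrite -(big_nat_widenl j 0 n.+1 xpredT) // -{2}[j]add0n big_addn.
  (* The indices i from n+1-j on lie beyond the last antidiagonal, where [f] vanishes. *)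
  rewrite [LHS](@big_cat_nat _ _ _ (n.+1 - j)) ?leq_subr //=.
  rewrite [X in _ + X]big_nat_cond [X in _ + X]big1 ?addr0.
    by apply: eq_bigr => i _; rewrite addnK.
  by move=> i lt_i; apply: f0; lia.
rewrite (exchange_big_dep_nat xpredT) //=; apply: eq_big_nat => k /andP[_ lt_kn].
by rewrite (big_nat_widen 0 k.+1 n.+1).
Qed.

Lemma natr_Zq_neq0 m : (0 < m)%N -> m%:R != 0 :> Zq.
Proof.
move=> m_gt0; rewrite -(rmorph_nat (@tofrac _)) tofrac_eq0.
by rewrite -(rmorph_nat (@polyC int)) polyC_eq0 pnatr_eq0 -lt0n.
Qed.

Theorem theorem17 (a b : nat) (ha : (0 < a)%N) (hb : (0 < b)%N) (n : nat) :
  tofrac (qbifib a b (2 * n + 2)) =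
  a%:R * \sum_(0 <= i < n.+1) \sum_(0 <= j < n.+1)
    (a * b)%:R ^ xi (n%:Z - i%:Z - j%:Z)
    * qvar ^+ (i ^ 2 + (n + i + 1) * j)
    * qbinom (n - j) i * qbinom (n - i) j
    * (a * b)%:R ^ (2 * floor_half (n%:Z - i%:Z - j%:Z)) :> Zq.
Proof.
have -> : (2 * n + 2 = n.*2.+1.+1)%N by lia.
rewrite qbifib_fibsum oddS odd_double /fibsum /= uphalf_double.
rewrite sum_antidiagonals; last first.
  (* If i > n, truncation makes n-i zero and [0, 0] = 1 may occur; then the other binomial vanishes,
     as n-j < i. *)
  move=> i j lt_n; case: (leqP i n) => [le_in|lt_ni].
    by rewrite (@qbinom_small (n - i)) ?mulr0 ?mul0r //; lia.
  by rewrite (@qbinom_small (n - j)) ?mulr0 ?mul0r //; lia.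
congr (_ * _); apply: eq_big_nat => k /andP[_ lt_kn].
(* This is the convolution with r = s = n-k+1. *)
have -> : qbinom (n.*2.+1 - k) k
          = qbinom ((n - k).+1 + (n - k).+1 + k).-1 k by congr qbinom; lia.
rewrite -qVandermonde mulr_sumr; apply: eq_big_nat => j /andP[_ lt_jk].
rewrite -mulrA mulrC.
have x_neq0 : (a * b)%:R != 0 :> Zq by rewrite natr_Zq_neq0 ?muln_gt0 ?ha.
set m := (_ - _ - _ : int).
have -> : (a * b)%:R ^+ (n - k) = (a * b)%:R ^ xi m * (a * b)%:R ^ (2 * floor_half m) :> Zq.
  by rewrite -expfzDr // /xi subrK /m exprnP; congr (_ ^ _); lia.
have -> : (n - j = ((n - k).+1 + (k - j)).-1)%N by lia.
have -> : (n - (k - j) = ((n - k).+1 + j).-1)%N by lia.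
(* On the antidiagonal the exponent splits into k^2 and the convolution weight r j. *)
have -> : ((k - j) ^ 2 + (n + (k - j) + 1) * j = k ^ 2 + (n - k).+1 * j)%N by nia.
by rewrite exprD; ring.
Qed.
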